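(* Let $A$ and $B$ be two unbounded self-adjoint operators on a complex Hilbert space $H$ such that $B$ is invertible. If $AB\subset BA$, then $A$ and $B$ strongly commute whenever $AB$ is densely defined.
   Context: All operators are linear. ''Unbounded operator'' means a densely defined, not necessarily bounded, linear operator $A$ with domain $D(A)\subset H$. $A\subset B$ means $D(A)\subset D(B)$ and $A$, $B$ coincide on $D(A)$. The product $BA$ is defined by $(BA)x=B(Ax)$ on $D(BA)=\{x\in D(A): Ax\in D(B)\}$. An unbounded operator $B$ is invertible if there is an everywhere defined bounded operator $B^{-1}$ on $H$ with $B^{-1}B\subset BB^{-1}=I$. Two self-adjoint operators $A$ and $B$ strongly commute if all the projections in their associated projection-valued (spectral) measures commute; equivalently, $e^{itA}e^{isB}=e^{isB}e^{itA}$ for all $s,t\in\mathbb{R}$. *)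

(* Defs.v *)
From HB Require Import structures.
From mathcomp Require Import all_boot all_order all_algebra complex.
From mathcomp Require Import all_classical all_reals all_analysis.

Set Implicit Arguments.
Unset Strict Implicit.
Unset Printing Implicit Defensive.

Import Order.TTheory GRing.Theory Num.Theory numFieldNormedType.Exports.

Local Open Scope classical_set_scope.
Local Open Scope ring_scope.
Local Open Scope complex_scope.

HB.mixin Record CompleteNormedModule_isHilbert (R : realType) (H : Type)
    of CompleteNormedModule R[i] H := {
  inner : {dot H for Num.conj};
  inner_norm : forall x : H, inner x x = `|x| ^+ 2
}.

#[short(type="hilbertType")]
HB.structure Definition Hilbert (R : realType) :=
  {H of CompleteNormedModule_isHilbert R H & CompleteNormedModule R[i] H}.

Section Operators.
Context {R : realType} {H : hilbertType R}.

(* Values of [op_fun] outside [op_dom] are irrelevant. *)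
Record linop := Linop {
  op_dom : set H;
  op_fun :> H -> H;
  op_dom0 : op_dom 0;
  op_dom_linear : forall (c : R[i]) x y,
    op_dom x -> op_dom y -> op_dom (c *: x + y);
  op_fun_linear : forall (c : R[i]) x y, op_dom x -> op_dom y ->
    op_fun (c *: x + y) = c *: op_fun x + op_fun y
}.

Implicit Types A B C : linop.

Definition densely_defined A := dense (op_dom A).

Definition op_sub A B :=
  op_dom A `<=` op_dom B /\ (forall x, op_dom A x -> A x = B x).

Definition op_eq A B := op_sub A B /\ op_sub B A.

Lemma op_id_linear (c : R[i]) (x y : H) :
  setT x -> setT y -> id (c *: x + y) = c *: id x + id y.
Proof. by []. Qed.

Definition op_id : linop :=
  @Linop setT id I (fun _ _ _ _ _ => I) op_id_linear.

Section Product.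
Variables B A : linop.

Definition op_prod_dom := [set x | op_dom A x /\ op_dom B (A x)].
Definition op_prod_fun := B \o A.

Lemma op_prod_has0 : op_prod_dom 0.
Proof.
have := op_fun_linear (- 1) (op_dom0 A) (op_dom0 A).
rewrite scaler0 add0r scaleN1r addNr => A0.
by split; rewrite /= ?A0; exact: op_dom0.
Qed.

Lemma op_prod_domL (c : R[i]) x y :
  op_prod_dom x -> op_prod_dom y -> op_prod_dom (c *: x + y).
Proof.
move=> [Ax BAx] [Ay BAy]; split; first exact: op_dom_linear.
by rewrite /= op_fun_linear//; exact: op_dom_linear.
Qed.

Lemma op_prod_funL (c : R[i]) x y :
  op_prod_dom x -> op_prod_dom y ->
  op_prod_fun (c *: x + y) = c *: op_prod_fun x + op_prod_fun y.
Proof. by move=> [Ax BAx] [Ay BAy]; rewrite /op_prod_fun/= !op_fun_linear. Qed.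

Definition op_prod : linop :=
  Linop op_prod_has0 op_prod_domL op_prod_funL.

End Product.

Definition bounded_everywhere C :=
  op_dom C = setT /\ exists M : R[i], forall x, `|C x| <= M * `|x|.

Definition invertible_op B := exists C,
  [/\ bounded_everywhere C,
      op_sub (op_prod C B) (op_prod B C) &
      op_eq (op_prod B C) op_id].

Definition op_graph A : set (H * H) := [set p | op_dom A p.1 /\ A p.1 = p.2].

(* The pairs (y, z) with y in D(A* ) and z = A* y; when A is densely defined, z
   is determined by y. *)
Definition adjoint_graph A : set (H * H) :=
  [set p | forall x, op_dom A x -> inner (A x) p.1 = inner x p.2].

Definition self_adjoint A :=
  densely_defined A /\ op_graph A = adjoint_graph A.

(* A projection-valued measure on the Borel sets of R; its values on other sets
   are irrelevant. *)
Record pvm := Pvm {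
  pvm_proj :> set R -> {linear H -> H};
  pvm_idem : forall S, measurable S ->
    forall x, pvm_proj S (pvm_proj S x) = pvm_proj S x;
  pvm_sym : forall S, measurable S ->
    forall x y, inner (pvm_proj S x) y = inner x (pvm_proj S y);
  pvm0 : forall x, pvm_proj set0 x = 0;
  pvmT : forall x, pvm_proj setT x = x;
  pvmI : forall S T, measurable S -> measurable T ->
    forall x, pvm_proj (S `&` T) x = pvm_proj S (pvm_proj T x);
  pvm_sigma_additive : forall F : (set R)^nat,
    (forall n, measurable (F n)) -> trivIset setT F ->
    forall x, (fun n => \sum_(0 <= k < n) pvm_proj (F k) x) @ \oo -->
              pvm_proj (\bigcup_n F n) x
}.

(* S |-> <E(S)x, x>, written as |E(S)x|^2 so that it is nonnegative even on the
   irrelevant non-Borel sets. *)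
Definition pvm_mu (E : pvm) (x : H) (S : set R) : \bar R :=
  (complex.Re (`|E S x| ^+ 2))%:E.

Lemma pvm_muE (E : pvm) x S : measurable S ->
  pvm_mu E x S = (complex.Re (inner (E S x) x))%:E.
Proof.
by move=> mS; rewrite /pvm_mu -inner_norm pvm_sym// pvm_idem// -pvm_sym.
Qed.

Lemma pvm_mu0 (E : pvm) x : pvm_mu E x set0 = 0%E.
Proof. by rewrite /pvm_mu pvm0 normr0 expr0n. Qed.

Lemma pvm_mu_ge0 (E : pvm) x S : (0 <= pvm_mu E x S)%E.
Proof.
by rewrite lee_fin -lecR RRe_real ?exprn_ge0// ger0_real// exprn_ge0.
Qed.

Lemma Re_normE (v : H) : `|v| = (complex.Re `|v|)%:C.
Proof. by rewrite RRe_real// normr_real. Qed.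

Lemma Re_norm_cvg (u : nat -> H) (v : H) : u @ \oo --> v ->
  (fun n => complex.Re `|u n|) @ \oo --> complex.Re `|v|.
Proof.
move=> uv; apply/cvgrPdist_lt => e e0.
have e0' : 0 < e%:C :> R[i] by rewrite ltcR.
move/cvgrPdist_lt : uv => /(_ _ e0').
apply: filterS => n uvn; rewrite -ltcR; apply: le_lt_trans uvn.
have -> : `|complex.Re `|v| - complex.Re `|u n| |%:C =
    `|(complex.Re `|v| - complex.Re `|u n|)%:C : R[i]|.
  by rewrite normc_def/= expr0n/= addr0 sqrtr_sqr.
by rewrite rmorphB/= -!Re_normE ler_dist_dist.
Qed.

Lemma pvm_mu_sum (E : pvm) x (F : (set R)^nat) n : (forall n, measurable (F n)) ->
  trivIset setT F ->
  `|\sum_(0 <= k < n) E (F k) x| ^+ 2 = \sum_(0 <= k < n) `|E (F k) x| ^+ 2.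
Proof.
move=> mF tF; elim: n => [|n IH]; first by rewrite !big_nil normr0 expr0n.
rewrite !big_nat_recr//= -IH -!inner_norm hnormDd//.
rewrite linear_sumlz/= big_nat big1// => k /andP[_ kn].
rewrite pvm_sym// -pvmI//.
have -> : F k `&` F n = set0.
  by move/trivIsetP : tF; apply => //; rewrite lt_eqF.
by rewrite pvm0 linear0r.
Qed.

Lemma pvm_mu_semi_sigma_additive (E : pvm) x : semi_sigma_additive (pvm_mu E x).
Proof.
move=> F mF tF mUF.
have -> : (fun n => \sum_(0 <= i < n) pvm_mu E x (F i))%E =
    (fun n => ((complex.Re `|\sum_(0 <= i < n) E (F i) x|) ^+ 2)%:E).
  apply/funext => n; rewrite /pvm_mu sumEFin; congr (_%:E).
  apply: complexI; rewrite rmorphXn/= -Re_normE pvm_mu_sum// rmorph_sum/=.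
  by apply: eq_bigr => i _; rewrite RRe_real// rpredX// normr_real.
have -> : pvm_mu E x (\bigcup_n F n) =
    ((complex.Re `|E (\bigcup_n F n) x|) ^+ 2)%:E.
  congr (_%:E); apply: complexI.
  by rewrite rmorphXn/= -Re_normE RRe_real// rpredX// normr_real.
apply: cvg_EFin; first by near=> n.
have c := Re_norm_cvg (@pvm_sigma_additive E _ mF tF x).
by apply: cvgM.
Unshelve. all: by end_near. Qed.

HB.instance Definition _ (E : pvm) x := isMeasure.Build _ R R (pvm_mu E x)
  (pvm_mu0 E x) (pvm_mu_ge0 E x) (@pvm_mu_semi_sigma_additive E x).

(* A = \int t dE(t): D(A) consists of the x with \int t^2 d<E(t)x, x> < +oo, and
   <Ax, x> = \int t d<E(t)x, x> on D(A), which determines A by polarization. *)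
Definition spectral_measure_of A (E : pvm) :=
  (forall x, op_dom A x <-> (\int[pvm_mu E x]_t (t ^+ 2)%:E < +oo)%E) /\
  (forall x, op_dom A x -> inner (A x) x = (\int[pvm_mu E x]_t t)%:C).

(* By the spectral theorem, a self-adjoint operator has exactly one spectral
   measure, up to its irrelevant values on non-Borel sets. *)
Definition strongly_commute A B :=
  forall E F : pvm, spectral_measure_of A E -> spectral_measure_of B F ->
  forall S T, measurable S -> measurable T ->
  forall x, E S (F T x) = F T (E S x).

End Operators.

Arguments linop R H : clear implicits.
Arguments pvm R H : clear implicits.

(* Main.v *)
(** Let C be the inverse of B. Applying AB <= BA to Cy with y in D(A) gives
  CA <= AC at once, <= being inclusion of operators. So everything reduces
  to: a bounded symmetric K with KA <= AK commutes with the spectral measure E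
  of A. This is used for K = C and A, and then for each E(S) and B, because
  E(S)C = CE(S) yields E(S)B <= BE(S).

  To prove the reduction, put X = E(T)KE(S), where S = ]c, c + 1] and T lies
  in [c + d, +oo[ with d > 1. Since E reduces A, X intertwines A - c on the two
  spectral subspaces; A - c is a contraction on Ran E(S) and expands norms by
  at least d on Ran E(T), so d^n |Xy| <= |K| |y| for all n, and X = 0.
  Countable unions of such pairs give E(]a, +oo[)KE(]-oo, a]) = 0; taking
  adjoints, K commutes with E(]a, +oo[), and these rays generate the Borel
  sets. *)

Require Import Defs.
From HB Require Import structures.
From mathcomp Require Import all_boot all_order all_algebra complex.
From mathcomp Require Import all_classical all_reals all_analysis.
From mathcomp Require Import measurable_realfun.
From mathcomp Require Import lra.

Set Implicit Arguments.
Unset Strict Implicit.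
Unset Printing Implicit Defensive.

Import Order.TTheory GRing.Theory Num.Theory numFieldNormedType.Exports.

Local Open Scope classical_set_scope.
Local Open Scope ring_scope.
Local Open Scope complex_scope.

(** * The real part of the inner product, in which all estimates are made *)

Section RealInner.
Context {R : realType} {H : hilbertType R}.
Implicit Types x y z : H.

Definition rinner x y : R := complex.Re (inner x y).

Lemma ReD (a b : R[i]) : complex.Re (a + b) = complex.Re a + complex.Re b.
Proof. by case: a => ? ?; case: b. Qed.

Lemma ReZ (c : R) (a : R[i]) : complex.Re (c%:C * a) = c * complex.Re a.
Proof. by case: a => a b /=; rewrite mul0r subr0. Qed.

Lemma ReJ (a : R[i]) : complex.Re (Num.conj a) = complex.Re a.
Proof. by case: a. Qed.

Lemma innerC x y : inner x y = Num.conj (inner y x).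
Proof. by rewrite hermC expr0 mul1r. Qed.

Lemma innerBl x y z : inner (x - y) z = inner x z - inner y z.
Proof. exact: linearBl. Qed.

Lemma innerZl a x y : inner (a *: x) y = a * inner x y.
Proof. exact: linearZl_LR. Qed.

Lemma inner0r x : inner x 0 = 0.
Proof. exact: linear0r. Qed.

Lemma rinnerC x y : rinner x y = rinner y x.
Proof. by rewrite /rinner innerC ReJ. Qed.

Lemma rinnerDl x y z : rinner (x + y) z = rinner x z + rinner y z.
Proof. by rewrite /rinner linearDl ReD. Qed.

Lemma rinnerDr x y z : rinner z (x + y) = rinner z x + rinner z y.
Proof. by rewrite !(rinnerC z) rinnerDl. Qed.

Lemma rinnerZl (c : R) x z : rinner (c%:C *: x) z = c * rinner x z.
Proof. by rewrite /rinner innerZl ReZ. Qed.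

Lemma rinnerZr (c : R) x z : rinner z (c%:C *: x) = c * rinner z x.
Proof. by rewrite !(rinnerC z) rinnerZl. Qed.

Lemma rinnerNl x z : rinner (- x) z = - rinner x z.
Proof. by rewrite -scaleN1r -(rmorphN1 (real_complex R)) rinnerZl mulN1r. Qed.

Lemma rinnerNr x z : rinner z (- x) = - rinner z x.
Proof. by rewrite !(rinnerC z) rinnerNl. Qed.

Lemma rinner0l z : rinner 0 z = 0.
Proof. by rewrite /rinner linear0l. Qed.

Lemma rinnerE x : (rinner x x)%:C = `|x| ^+ 2.
Proof. by rewrite /rinner inner_norm RRe_real// rpredX// normr_real. Qed.

Lemma rinner_ge0 x : 0 <= rinner x x.
Proof. by rewrite -lecR rinnerE exprn_ge0. Qed.

Lemma rinner_eq0 x : rinner x x = 0 -> x = 0.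
Proof.
move=> /(congr1 (fun r : R => r%:C)); rewrite rinnerE => /eqP.
by rewrite expf_eq0/= normr_eq0 => /eqP.
Qed.

Lemma inner_ext x y : (forall z, inner x z = inner y z) -> x = y.
Proof.
move=> xy; apply/eqP; rewrite -subr_eq0; apply/eqP/rinner_eq0.
by rewrite /rinner innerBl xy subrr.
Qed.

End RealInner.

(** * Symmetry and density of the domain for self-adjoint operators *)

Section SelfAdjoint.
Context {R : realType} {H : hilbertType R}.
Implicit Types (A : linop R H) (x y z : H).

Lemma sa_sym A x y : self_adjoint A -> op_dom A x -> op_dom A y ->
  inner (A x) y = inner x (A y).
Proof.
move=> [_ gA] Dx Dy.
have : op_graph A (y, A y) by [].
by rewrite gA => /(_ x Dx).
Qed.

(** Such a z puts (0, z) in the adjoint graph, hence in the graph of A, so z = A 0. *)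
Lemma sa_orth A z : self_adjoint A ->
  (forall x, op_dom A x -> inner x z = 0) -> z = 0.
Proof.
move=> [_ gA] z0.
have : adjoint_graph A (0, z) by move=> x Dx; rewrite /= z0// inner0r.
rewrite -gA => -[_ /= <-].
have := op_fun_linear (- 1) (op_dom0 A) (op_dom0 A).
by rewrite !scaleN1r !addNr.
Qed.

Lemma op_domZ A (c : R[i]) x : op_dom A x -> op_dom A (c *: x).
Proof.
move=> Dx; rewrite -[c *: x]addr0.
by apply: op_dom_linear => //; exact: op_dom0.
Qed.

Lemma op_domD A x y : op_dom A x -> op_dom A y -> op_dom A (x + y).
Proof. by move=> Dx Dy; rewrite -[x]scale1r; exact: op_dom_linear. Qed.

Lemma op_domB A x y : op_dom A x -> op_dom A y -> op_dom A (x - y).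
Proof. by move=> Dx Dy; rewrite -scaleN1r addrC; exact: op_dom_linear. Qed.

Lemma op_funD A x y : op_dom A x -> op_dom A y -> A (x + y) = A x + A y.
Proof. by move=> Dx Dy; have := op_fun_linear 1 Dx Dy; rewrite !scale1r. Qed.

Lemma op_funB A x y : op_dom A x -> op_dom A y -> A (x - y) = A x - A y.
Proof.
move=> Dx Dy; have := op_fun_linear (- 1) Dy Dx.
by rewrite !scaleN1r !(addrC (- _)).
Qed.

Lemma sa_rinner_orth A z : self_adjoint A ->
  (forall x, op_dom A x -> rinner x z = 0) -> z = 0.
Proof.
move=> sA z0; apply: (sa_orth sA) => x Dx.
(* Testing against ix as well as x recovers the imaginary part. *)
have := z0 _ Dx; have := z0 _ (op_domZ 'i Dx).
rewrite /rinner innerZl; case: (inner x z) => a b /=.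
by rewrite mul0r mul1r sub0r => /eqP; rewrite oppr_eq0 => /eqP -> ->.
Qed.

End SelfAdjoint.

(** * Quadratic-form bounds and reduction of A by its spectral measure *)

Section Moments.
Context {R : realType} {H : hilbertType R}.
Variables (A : linop R H) (E : pvm R H).
Hypotheses (sA : self_adjoint A) (EA : spectral_measure_of A E).
Implicit Types (x y : H) (S T : set R).

Lemma pvm_muEr x S : pvm_mu E x S = (rinner (E S x) (E S x))%:E.
Proof. by rewrite /pvm_mu /rinner inner_norm. Qed.

Lemma pvm_eq0 S x : pvm_mu E x S = 0%E -> E S x = 0.
Proof. by rewrite pvm_muEr => -[] /rinner_eq0. Qed.

(** E(S)x = 0 says that S is null for [pvm_mu E x], and null sets are stable under countable unions,
    disjoint or not. *)
Lemma pvm_bigcup0 (F : (set R)^nat) x : (forall n, measurable (F n)) ->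
  (forall n, E (F n) x = 0) -> E (\bigcup_n F n) x = 0.
Proof.
move=> mF F0; apply: pvm_eq0; apply/negligibleP; first exact: bigcup_measurable.
apply: negligible_bigcup => n; apply/negligibleP => //=.
by rewrite pvm_muEr F0 rinner0l.
Qed.

Lemma pvmU0 S T x : measurable S -> measurable T ->
  E S x = 0 -> E T x = 0 -> E (S `|` T) x = 0.
Proof.
move=> mS mT Sx Tx; rewrite -bigcup2E; apply: pvm_bigcup0 => -[|[|n]]//=.
by rewrite pvm0.
Qed.

Lemma pvmC S x : measurable S -> E (~` S) x = x - E S x.
Proof.
move=> mS; have mCS : measurable (~` S) by exact: measurableC.
apply/eqP; rewrite eq_sym -subr_eq0; apply/eqP.
rewrite -[LHS](pvmT E) -(setUv S); apply: pvmU0 => //.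
  by rewrite !linearB/= pvm_idem// -pvmI// setICr pvm0 subrr subr0.
by rewrite !linearB/= pvm_idem// -pvmI// setICl pvm0 subr0 subrr.
Qed.

(** The measure attached to E(S)x is that of x restricted to S, because E(T)E(S) = E(T) for T inside
    S and E(S^c)E(S) = 0. *)
Lemma integral_pvm_restrict S x (f : R -> \bar R) : measurable S ->
  measurable_fun [set: R] f ->
  (\int[pvm_mu E (E S x)]_t f t = \int[pvm_mu E x]_(t in S) f t)%E.
Proof.
move=> mS mf.
have mCS : measurable (~` S) by exact: measurableC.
rewrite -(setUv S) integral_setU//; last 2 first.
- by rewrite setUv.
- by apply/disj_setPS; rewrite setICr.
rewrite [X in (_ + X)%E]null_set_integral//; last 2 first.
- exact: measurable_funS mf.
- by rewrite /= pvm_muEr -pvmI// setICl pvm0 rinner0l.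
rewrite adde0; apply: eq_measure_integral => T mT TS /=.
by rewrite !pvm_muEr -pvmI// setIidl.
Qed.

Lemma measurable_sqrE : measurable_fun [set: R] (fun t => (t ^+ 2)%:E).
Proof. by apply/measurable_EFinP; exact: measurable_funX. Qed.

Lemma pvm_dom S x : measurable S -> op_dom A x -> op_dom A (E S x).
Proof.
move=> mS /EA.1 x2; apply/EA.1; rewrite integral_pvm_restrict//; last first.
  exact: measurable_sqrE.
apply: le_lt_trans x2; apply: ge0_subset_integral => //.
- exact: measurable_sqrE.
- by move=> t _; rewrite lee_fin sqr_ge0.
Qed.

Lemma pvm_dom_bounded S x (b : R) : measurable S ->
  (forall t, S t -> t ^+ 2 <= b) -> E S x = x -> op_dom A x.
Proof.
move=> mS Sb <-; apply/EA.1; rewrite integral_pvm_restrict//; last first.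
  exact: measurable_sqrE.
apply: (@le_lt_trans _ _ (\int[pvm_mu E x]_(t in S) (cst b%:E) t)%E).
  apply: ge0_le_integral => //.
  - by move=> t _; rewrite lee_fin sqr_ge0.
  - exact: measurable_funS measurable_sqrE.
by rewrite integral_cst//= pvm_muEr -EFinM ltry.
Qed.

Lemma pvm_integrable_cst S x (b : R) : measurable S ->
  (pvm_mu E x).-integrable S (EFin \o cst b).
Proof.
move=> mS; apply/integrableP; split; first by apply/measurable_EFinP.
rewrite -[X in (X < _)%E]/(\int[pvm_mu E x]_(t in S) cst `|b|%:E t)%E.
by rewrite integral_cst//= pvm_muEr -EFinM ltry.
Qed.

Lemma pvm_integrable_id S x : measurable S -> op_dom A x ->
  (pvm_mu E x).-integrable S (EFin \o id).
Proof.
move=> mS /EA.1 x2; apply: (@integrableS _ _ _ _ setT) => //.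
have abs_le (u : R) : `|u| <= 1 + u ^+ 2.
  by rewrite ler_norml; apply/andP; split; nra.
have i1 := pvm_integrable_cst x 1 (@measurableT _ R).
have i2 : (pvm_mu E x).-integrable setT (fun t => (t ^+ 2)%:E).
  apply/integrableP; split; first exact: measurable_sqrE.
  by under eq_integral do rewrite gee0_abs ?lee_fin ?sqr_ge0//.
apply: (le_integrable _ _ _ (integrableD measurableT i1 i2)) => //.
  exact/measurable_EFinP.
by move=> t _ /=; rewrite lee_fin [leRHS]ger0_norm ?addr_ge0 ?sqr_ge0.
Qed.

Lemma form_restrict S x : measurable S -> op_dom A x ->
  rinner (A (E S x)) (E S x) = \int[pvm_mu E x]_(t in S) t.
Proof.
move=> mS Dx; rewrite /rinner EA.2/=; last exact: pvm_dom.
by rewrite /Rintegral integral_pvm_restrict//; exact/measurable_EFinP.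
Qed.

Lemma form_ge S x (b : R) : measurable S -> (forall t, S t -> b <= t) ->
  op_dom A x -> E S x = x -> b * rinner x x <= rinner (A x) x.
Proof.
move=> mS Sb Dx xS; rewrite -{3 4}xS form_restrict//.
have <- : \int[pvm_mu E x]_(t in S) b = b * rinner x x.
  rewrite Rintegral_cst//; congr (_ * _).
  by have /(congr1 fine) := pvm_muEr x S; rewrite xS.
apply: le_Rintegral => //; [exact: pvm_integrable_cst|exact: pvm_integrable_id].
Qed.

Lemma form_le S x (b : R) : measurable S -> (forall t, S t -> t <= b) ->
  op_dom A x -> E S x = x -> rinner (A x) x <= b * rinner x x.
Proof.
move=> mS Sb Dx xS; rewrite -{1 2}xS form_restrict//.
have <- : \int[pvm_mu E x]_(t in S) b = b * rinner x x.
  rewrite Rintegral_cst//; congr (_ * _).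
  by have /(congr1 fine) := pvm_muEr x S; rewrite xS.
apply: le_Rintegral => //; [exact: pvm_integrable_id|exact: pvm_integrable_cst].
Qed.

Lemma form_split S x : measurable S -> op_dom A x ->
  rinner (A x) x = rinner (A (E S x)) (E S x) +
                   rinner (A (E (~` S) x)) (E (~` S) x).
Proof.
move=> mS Dx; have mCS : measurable (~` S) by exact: measurableC.
rewrite !form_restrict// -Rintegral_setU//; last 2 first.
- by apply: pvm_integrable_id => //; exact: measurableU.
- by apply/disj_setPS; rewrite setICr.
by rewrite setUv -form_restrict// !pvmT.
Qed.

(* Polarizing [form_split] over E(S)x + E(S^c)y kills the off-diagonal block. *)
Lemma form_offdiag S x y : measurable S -> op_dom A x -> op_dom A y ->
  rinner (A (E S x)) (E (~` S) y) = 0.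
Proof.
move=> mS Dx Dy; have mCS : measurable (~` S) by exact: measurableC.
have Du := pvm_dom mS Dx; have Dv := pvm_dom mCS Dy.
have := form_split mS (op_domD Du Dv).
rewrite !linearD/= -!pvmI// !setIid setICl setICr !pvm0 addr0 add0r.
rewrite op_funD// !rinnerDl !rinnerDr.
(* Symmetry of A makes the two cross terms equal; their sum is zero, so each is. *)
rewrite [rinner (A (E (~` S) y)) (E S x)]/rinner sa_sym// -/(rinner _ _).
rewrite (rinnerC (E (~` S) y)); lra.
Qed.

(** The vector E(T^c)AE(T)x is orthogonal to the dense D(A), hence zero. Taking T = S and T = S^c
    gives the two halves of the identity. *)
Lemma pvm_reduces S x : measurable S -> op_dom A x -> A (E S x) = E S (A x).
Proof.
move=> mS Dx; have mCS : measurable (~` S) by exact: measurableC.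
have off T : measurable T -> E (~` T) (A (E T x)) = 0.
  move=> mT; have mCT : measurable (~` T) by exact: measurableC.
  apply: (sa_rinner_orth sA) => y Dy; rewrite rinnerC.
  by rewrite /rinner pvm_sym//; exact: form_offdiag.
have AE : E S (A (E S x)) = A (E S x).
  by have := off _ mS; rewrite pvmC// => /subr0_eq.
have := off _ mCS; rewrite setCK pvmC// op_funB//; last exact: pvm_dom.
by rewrite linearB/= AE => /subr0_eq.
Qed.

End Moments.

(** * Bounded symmetric operators commuting with A commute with E *)

Lemma geometric_le_eq0 (R : realType) (p a C : R) : 1 < p -> 0 <= a ->
  (forall n, p ^+ n * a <= C) -> a = 0.
Proof.
move=> p1; rewrite le_eqVlt => /predU1P[<-//|a0 pC].
have bernoulli n : 1 + n%:R * (p - 1) <= p ^+ n.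
  elim: n => [|n IH]; first by rewrite mul0r addr0.
  have n0 : 0 <= n%:R :> R by [].
  have := ler_wpM2l (ltW (lt_trans ltr01 p1)) IH.
  have := mulr_ge0 n0 (sqr_ge0 (p - 1)).
  by rewrite [p ^+ n.+1]exprS -natr1; lra.
have pa : 0 < (p - 1) * a by rewrite mulr_gt0// subr_gt0.
have := truncnS_gt (C / ((p - 1) * a)).
rewrite ltr_pdivrMr//; set n := _.+1 => Cn.
by have := bernoulli n; have := pC n; nra.
Qed.

Section Commutant.
Context {R : realType} {H : hilbertType R}.
Variables (A : linop R H) (E : pvm R H) (K : {linear H -> H}) (M : R).
Hypotheses (sA : self_adjoint A) (EA : spectral_measure_of A E).
Hypothesis K_sym : forall x y, inner (K x) y = inner x (K y).
Hypothesis K_bounded : forall x, rinner (K x) (K x) <= M * rinner x x.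
Hypothesis KA : forall x, op_dom A x -> op_dom A (K x) /\ A (K x) = K (A x).
Implicit Types (x y z : H) (S T : set R).

Let shift (c : R) x := A x - c%:C *: x.

Lemma shift_contraction (c : R) y : E `]c, c + 1]%classic y = y ->
  [/\ op_dom A y, E `]c, c + 1]%classic (shift c y) = shift c y &
      rinner (shift c y) (shift c y) <= rinner y y].
Proof.
set S := `]c, c + 1]%classic => yS.
have mS : measurable S by exact: measurable_itv.
have SD x : E S x = x -> op_dom A x.
  apply: (@pvm_dom_bounded _ _ _ _ EA S _ ((`|c| + 1) ^+ 2)) => // t.
  rewrite /S/= in_itv/= => /andP[ct tc].
  have := ler_norm c; have := ler_norm (- c); rewrite normrN => cl cr.
  have h1 : 0 <= `|c| + 1 - t by lra.
  have h2 : 0 <= `|c| + 1 + t by lra.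
  by have := mulr_ge0 h1 h2; lra.
have Dy := SD _ yS.
have ySv : E S (shift c y) = shift c y.
  by rewrite /shift linearB linearZ/= -(pvm_reduces sA EA)// yS.
have Ay : A y = shift c y + c%:C *: y by rewrite /shift subrK.
split => //; move: (shift c y) Ay ySv => v Ay ySv.
have Dv := SD _ ySv.
have geS t : S t -> c <= t by rewrite /S/= in_itv/= => /andP[/ltW].
have leS t : S t -> t <= c + 1 by rewrite /S/= in_itv/= => /andP[].
have yvS : E S (y - v) = y - v by rewrite linearB/= yS ySv.
(* Put N = A - c, so v = Ny. Then 0 <= <N(y - v), y - v> = <v, y> - 2|v|^2 + <Nv, v>, while <v, y>
   <= |y|^2 and <Nv, v> <= |v|^2; hence |v|^2 <= |y|^2. *)
have := form_ge EA mS geS (op_domB Dy Dv) yvS.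
have := form_le EA mS leS Dv ySv; have := form_le EA mS leS Dy yS.
rewrite op_funB// !(rinnerDl, rinnerDr, rinnerNl, rinnerNr).
have -> : rinner (A v) y = rinner v (A y) by rewrite /rinner sa_sym.
rewrite Ay !(rinnerDl, rinnerDr, rinnerZl, rinnerZr) (rinnerC y v).
lra.
Qed.

Lemma shift_expansion (c d : R) T z : measurable T ->
  (forall t, T t -> c + d <= t) -> 0 <= d -> op_dom A z -> E T z = z ->
  d ^+ 2 * rinner z z <= rinner (shift c z) (shift c z).
Proof.
move=> mT Td d0 Dz zT; have := form_ge EA mT Td Dz zT.
have -> : A z = shift c z + c%:C *: z by rewrite /shift subrK.
move: (shift c z) => v.
(* Expanding the square gives 2d<v, z> <= |v|^2 + d^2 |z|^2, and the form bound gives <v, z> >= d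
   |z|^2. *)
have := rinner_ge0 (v - d%:C *: z).
rewrite !(rinnerDl, rinnerDr, rinnerNl, rinnerNr, rinnerZl, rinnerZr).
rewrite (rinnerC z).
nra.
Qed.

Lemma pvm_contraction S x : measurable S ->
  rinner (E S x) (E S x) <= rinner x x.
Proof.
move=> mS; have := rinner_ge0 (x - E S x).
rewrite !(rinnerDl, rinnerDr, rinnerNl, rinnerNr) (rinnerC x).
have -> : rinner (E S x) x = rinner (E S x) (E S x).
  by rewrite [in RHS]/rinner -pvm_sym// pvm_idem.
lra.
Qed.

(* E(T)K intertwines A - c on Ran E(]c, c + 1]), where it is a contraction, with
   A - c on Ran E(T), where it expands by d > 1. *)
Lemma block_separated (c d : R) T x : measurable T -> 1 < d ->
  (forall t, T t -> c + d <= t) -> E T (K (E `]c, c + 1]%classic x)) = 0.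
Proof.
move=> mT d1 Td; set S := `]c, c + 1]%classic.
have mS : measurable S by exact: measurable_itv.
have d0 : 0 <= d by lra.
pose X y := E T (K y).
(* Each step trades y for (A - c)y, which stays in Ran E(S) without growing, and gains a factor d^2.
   The absolute value of M keeps the right side monotone in |y|^2. *)
have iter n y : E S y = y ->
    (d ^+ 2) ^+ n * rinner (X y) (X y) <= `|M| * rinner y y.
  elim: n y => [|n IH] y yS.
    rewrite expr0 mul1r; apply: le_trans (pvm_contraction _ mT) _.
    apply: le_trans (K_bounded _) _.
    by rewrite ler_wpM2r ?rinner_ge0// ler_norm.
  have [Dy vS vy] := shift_contraction yS.
  have [DKy AKy] := KA Dy.
  have DX : op_dom A (X y) by exact: pvm_dom.
  have XS : E T (X y) = X y by rewrite /X pvm_idem.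
  have Xv : shift c (X y) = X (shift c y).
    by rewrite /shift /X (pvm_reduces sA EA)// AKy !linearB !linearZ.
  have := shift_expansion mT Td d0 DX XS; rewrite Xv => exp.
  rewrite exprSr -mulrA; apply: (@le_trans _ _
      ((d ^+ 2) ^+ n * rinner (X (shift c y)) (X (shift c y)))).
    by rewrite ler_wpM2l// exprn_ge0// sqr_ge0.
  apply: le_trans (IH _ vS) _.
  by rewrite ler_wpM2l.
apply: rinner_eq0; apply: (@geometric_le_eq0 _ (d ^+ 2)).
- by nra.
- exact: rinner_ge0.
- by move=> n; apply: iter; rewrite pvm_idem.
Qed.

Lemma block_sym S T : measurable S -> measurable T ->
  (forall x, E S (K (E T x)) = 0) -> forall x, E T (K (E S x)) = 0.
Proof.
move=> mS mT ST x; apply: inner_ext => z.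
by rewrite pvm_sym// K_sym pvm_sym// ST inner0r innerC inner0r conjC0.
Qed.

(** Since K is symmetric, the opposite off-diagonal block vanishes too. *)
Lemma block_comm S : measurable S ->
  (forall x, E (~` S) (K (E S x)) = 0) -> forall x, K (E S x) = E S (K x).
Proof.
move=> mS S0 x; have mCS : measurable (~` S) by exact: measurableC.
have := block_sym mCS mS S0 x; have := S0 x.
rewrite !pvmC// => /subr0_eq ->.
by rewrite !linearB/= => /subr0_eq.
Qed.

Lemma comm_ray (a : R) x :
  K (E `]a, +oo[%classic x) = E `]a, +oo[%classic (K x).
Proof.
set J := `]a, +oo[%classic; have mJ : measurable J by exact: measurable_itv.
pose S k := `]a - k%:R - 1, a - k%:R]%classic.
have mS k : measurable (S k) by exact: measurable_itv.
apply: block_comm => // {}x.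
have -> : ~` J = \bigcup_k S k.
  rewrite /J setCitvr; apply/seteqP.
  split => [t|t [k _]]; rewrite /S/= !in_itv/=.
    (* With k the integer part of a - t, k <= a - t < k + 1, which matches the half-open [S k]. *)
    move=> ta; exists (Num.truncn (a - t)) => //=; rewrite in_itv/=.
    have /truncn_itv/andP[] : 0 <= a - t by rewrite subr_ge0.
    by rewrite -natr1 => ? ?; apply/andP; split; lra.
  by move=> /andP[_]; have : 0 <= k%:R :> R by []; lra.
apply: pvm_bigcup0 => // k.
(* Unions are split in the outer projection only, so the adjoint brings J outside. *)
apply: block_sym => // {}x.
rewrite /J itvoyEbigcup; apply: pvm_bigcup0 => // n.
have n0 : 0 < n.+1%:R^-1 :> R by rewrite invr_gt0.
have k0 : 0 <= k%:R :> R by [].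
move: n.+1%:R^-1 n0 => e e0.
have -> : S k = `]a - k%:R - 1, a - k%:R - 1 + 1]%classic by rewrite subrK.
(* From c = a - k - 1 the distance to a + e is k + 1 + e. Cutting J at a + e, with e > 0, makes it
   exceed 1 even for k = 0. *)
apply: (@block_separated _ (k%:R + 1 + e)) => //; first by lra.
by move=> t /=; rewrite in_itv/= andbT; lra.
Qed.

Lemma pvm_commutant S : measurable S -> forall x, K (E S x) = E S (K x).
Proof.
pose comm := [set S : set R | measurable S /\ forall x, K (E S x) = E S (K x)].
suff : (measurable : set (set R)) `<=` comm by move=> sub /sub[].
have -> : (measurable : set (set R)) = <<s @RGenOInfty.G R >>.
  exact: RGenOInfty.measurableE.
apply: smallest_sub; last first.
  by move=> _ [a ->]; split; [exact: measurable_itv|exact: comm_ray].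
split.
- by split => [|x]; [exact: measurable0|rewrite !pvm0 linear0].
- move=> T [mT KT]; rewrite setTD; split => [|x]; first exact: measurableC.
  by rewrite !pvmC// linearB/= KT.
- move=> F KF; have mF n : measurable (F n) by case: (KF n).
  have mU : measurable (\bigcup_n F n) by exact: bigcup_measurable.
  split => //; apply: block_comm => //; apply: block_sym => //.
    exact: measurableC.
  move=> x; apply: pvm_bigcup0 => // n.
  rewrite -(KF n).2 -pvmI//; last exact: measurableC.
  rewrite (_ : F n `&` _ = set0) ?pvm0 ?linear0//.
  by apply/disjoints_subset; rewrite setCK; exact: bigcup_sup.
Qed.

End Commutant.

(** * The inverse of B and the two uses of the commutant result *)

Lemma bounded_rinner (R : realType) (H : hilbertType R) (f : H -> H)
    (M : R[i]) :
  (forall x, `|f x| <= M * `|x|) ->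
  forall x, rinner (f x) (f x) <= (complex.Re `|M|) ^+ 2 * rinner x x.
Proof.
move=> fM x; have := RRe_real (normr_real M).
move: (complex.Re _) => m mE.
rewrite -lecR rmorphM rmorphXn/= !rinnerE mE -exprMn.
rewrite lerXn2r ?nnegrE ?mulr_ge0//.
(* M is a complex number, but M|x| dominates a norm, so it equals its own modulus. *)
have Mx : 0 <= M * `|x| := le_trans (normr_ge0 _) (fM x).
by rewrite -(normr_id x) -normrM (ger0_norm Mx).
Qed.

Theorem proposition2 (R : realType) (H : hilbertType R) (A B : linop R H)
    (Asa : self_adjoint A) (Bsa : self_adjoint B) (Binv : invertible_op B)
    (ABsub : op_sub (op_prod A B) (op_prod B A))
    (ABdense : densely_defined (op_prod A B)) :
  strongly_commute A B.
Proof.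
have [C [[CT [M CM]] [_ CB] [[_ BC] [BCT _]]]] := Binv.
have domC x : op_dom C x by rewrite CT.
have BCE x : op_dom B (C x) /\ B (C x) = x.
  have [_ DBC] := BCT x I; split => //.
  by apply: BC.
have CBE x : op_dom B x -> C (B x) = x.
  move=> Bx; have DCB : op_dom (op_prod C B) x by split.
  exact: etrans (CB x DCB) (BCE x).2.
have C_lin : linear C by move=> c x y; exact: op_fun_linear.
pose K : {linear H -> H} :=
  HB.pack (op_fun C) (GRing.isLinear.Build _ _ _ _ C C_lin).
have K_sym x y : inner (K x) y = inner x (K y).
  (* Writing x = BCx and y = BCy passes the symmetry of B to its inverse. *)
  have [[Dx {2}<-] [Dy {1}<-]] := (BCE x, BCE y).
  by rewrite (sa_sym Bsa).
have KA x : op_dom A x -> op_dom A (K x) /\ A (K x) = K (A x).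
  move=> Dx; have [DBx BCx] := BCE x.
  (* At Cx the inclusion reads Ax = BACx; applying C gives CAx = ACx. *)
  have DAB : op_dom (op_prod A B) (C x) by split; rewrite ?BCx.
  have [/(_ _ DAB)[DACx DBAC] /(_ _ DAB)] := ABsub.
  rewrite /= /op_prod_fun/= BCx => AxE; split => //.
  by rewrite AxE CBE.
move=> E F EA FB S T mS mT x.
have EC := pvm_commutant Asa EA K_sym (bounded_rinner CM) KA mS.
apply: (pvm_commutant Bsa FB (M := 1)) => //.
- by move=> y z; rewrite pvm_sym.
- by move=> y; rewrite mul1r; exact: pvm_contraction.
(* E(S)y = E(S)CBy = CE(S)By lies in D(B), and B sends it to E(S)By. *)
move=> y Dy; have [DE BE] := BCE (E S (B y)).
have -> : E S y = C (E S (B y)) by have := EC (B y); rewrite /= CBE.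
by [].
Qed.
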